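(* Let $(S,\mathcal B,\mu)$, $G$ and the non-singular $G$-action $\mathcal G=\{\phi_t\}_{t\in G}$ be as in the context, let $P_{\mathcal G}$ be the (mod $\mu$ unique) maximal element of $I(\mathcal G)$ and $N_{\mathcal G}=S\setminus P_{\mathcal G}$. Let $f\in L^1(S,\mu)$ with $f>0$. Then: (i) for all $t\in G$, $\mu(\phi_t^{-1}(P_{\mathcal G})\triangle P_{\mathcal G})=0$ and $\mu(\phi_t^{-1}(N_{\mathcal G})\triangle N_{\mathcal G})=0$; (ii) for every sequence $\{u_n\}_{n\in\mathbb N}\subset G$, $\sum_{n=1}^\infty \widehat\phi_{u_n}f(s)=\infty$ for $\mu$-a.e. $s\in P_{\mathcal G}$; (iii) there exists a sequence $\{u_n\}_{n\in\mathbb N}\subset G$ such that $\sum_{n=1}^\infty \widehat\phi_{u_n}f(s)<\infty$ for $\mu$-a.e. $s\in N_{\mathcal G}$.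
   Context: $(S,\mathcal B,\mu)$ is a standard Lebesgue space with $\sigma$-finite $\mu$; $G$ is a locally compact abelian topological group. A map $\phi$ is non-singular if it is invertible, bi-measurable and $\mu\circ\phi^{-1}\sim\mu$. A $G$-action is a family $\{\phi_t\}_{t\in G}$ of measurable maps with $\phi_0=\mathrm{id}$, $\phi_{u+v}=\phi_u\circ\phi_v$, and $(s,u)\mapsto\phi_u(s)$ jointly measurable; non-singular if each $\phi_t$ is. The dual operator of a non-singular $\phi$ is $\widehat\phi f(s)=\frac{d\mu\circ\phi^{-1}}{d\mu}(s)\,f(\phi^{-1}(s))$ for $f\in L^1(S,\mu)$. $\Lambda(\mathcal G)$ is the set of finite measures $\nu\ll\mu$ with $\nu\circ\phi_t^{-1}=\nu$ for all $t$; $S_\nu=\{d\nu/d\mu>0\}$; $I(\mathcal G)=\{S_\nu:\nu\in\Lambda(\mathcal G)\}$; its maximal element mod $\mu$ is a set $P_{\mathcal G}\in I(\mathcal G)$ with $\mu(S_\nu\setminus P_{\mathcal G})=0$ for all $S_\nu\in I(\mathcal G)$ (it exists and is unique mod $\mu$). $P_{\mathcal G}$ and $N_{\mathcal G}$ are called the positive and null parts; $\mathcal G$ is called positive if $\mu(N_{\mathcal G})=0$ and null if $\mu(P_{\mathcal G})=0$. *)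

(* Defs.v *)
From HB Require Import structures.
From mathcomp Require Import all_boot all_order all_algebra.
From mathcomp Require Import all_classical all_reals all_analysis measurable_realfun.

Set Implicit Arguments.
Unset Strict Implicit.
Unset Printing Implicit Defensive.
Import Order.TTheory GRing.Theory Num.Theory.
Local Open Scope classical_set_scope.
Local Open Scope ring_scope.
Local Open Scope ereal_scope.

Definition borel_sets (G : topologicalType) : set (set G) := <<s @open G >>.

Definition prod_sets d (S : measurableType d) (G : topologicalType)
  : set (set (S * G)) :=
  <<s [set Z | exists X Y, measurable X /\ borel_sets Y /\ Z = X `*` Y] >>.

Definition symdiff {T} (A B : set T) : set T := (A `\` B) `|` (B `\` A).

(* (S, B) is standard: Borel-isomorphic to a Borel subset of the reals. *)
Definition standard_borel d (S : measurableType d) (R : realType) : Prop :=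
  exists g : S -> R^o,
    injective g /\ measurable_fun [set: S] g /\
    (forall A, measurable A -> measurable (g @` A)).

Definition nonsingular d (S : measurableType d) (R : realType)
  (mu : set S -> \bar R) (phi : S -> S) : Prop :=
  bijective phi /\ measurable_fun [set: S] phi /\
  (forall A, measurable A -> measurable (phi @` A)) /\
  (forall A, measurable A -> (mu (phi @^-1` A) = 0 <-> mu A = 0)).

Definition measurable_action d (S : measurableType d) (G : topologicalZmodType)
  (phi : G -> S -> S) : Prop :=
  phi 0%R = id /\ (forall u v, phi (u + v)%R = phi u \o phi v) /\
  (forall A, measurable A ->
     @prod_sets d S G [set p : S * G | A (phi p.2 p.1)]).

Definition is_density d (S : measurableType d) (R : realType)
  (mu nu : set S -> \bar R) (h : S -> \bar R) : Prop :=
  measurable_fun [set: S] h /\ (forall s, 0 <= h s) /\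
  (forall A, measurable A -> nu A = \int[mu]_(x in A) h x).

(* d nu / d mu (a chosen version; 0 if none exists) *)
Definition RNderiv d (S : measurableType d) (R : realType)
  (mu nu : set S -> \bar R) : S -> \bar R :=
  match pselect (exists h, is_density mu nu h) with
  | left e => projT1 (cid e)
  | right _ => fun _ => 0
  end.

Definition dual_op d (S : measurableType d) (R : realType)
  (mu : set S -> \bar R) (phi phiinv : S -> S) (f : S -> R) : S -> \bar R :=
  fun s => RNderiv mu (pushforward mu phi) s * (f (phiinv s))%:E.

Definition Lambda d (S : measurableType d) (R : realType) (G : zmodType)
  (mu : {measure set S -> \bar R}) (phi : G -> S -> S)
  (nu : {measure set S -> \bar R}) : Prop :=
  nu [set: S] < +oo /\ nu `<< mu /\
  (forall t A, measurable A -> nu (phi t @^-1` A) = nu A).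

Definition supp_set d (S : measurableType d) (R : realType)
  (mu nu : set S -> \bar R) : set S := [set s | 0 < RNderiv mu nu s].

(* P is (a version of) the maximal element of I(G) mod mu *)
Definition is_positive_part d (S : measurableType d) (R : realType)
  (G : zmodType) (mu : {measure set S -> \bar R}) (phi : G -> S -> S)
  (P : set S) : Prop :=
  measurable P /\
  (exists nu, Lambda mu phi nu /\ mu (symdiff P (supp_set mu nu)) = 0) /\
  (forall nu, Lambda mu phi nu -> mu (supp_set mu nu `\` P) = 0).

(* Main.v *)
Require Import Defs.
From HB Require Import structures.
From mathcomp Require Import all_boot all_order all_algebra.
From mathcomp Require Import all_classical all_reals all_analysis measurable_realfun.
Import Order.TTheory GRing.Theory Num.Theory.
Import numFieldNormedType.Exports.
Local Open Scope classical_set_scope.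
Local Open Scope ring_scope.
Local Open Scope ereal_scope.

Set Implicit Arguments.
Unset Strict Implicit.

(** Let [m = f mu], a finite measure equivalent to [mu]; the dual operator at
    [u] applied to [f] is the density of [m \o phi_u^-1].

    On the positive part: if the series of densities is integrable on [B], then
    [m (phi_(u n)^-1 B)] is summable, so Borel-Cantelli makes the limsup of the
    sets [phi_(u n)^-1 B] null for [m], hence for an invariant finite
    [nu << mu]; since each of them has [nu]-measure [nu B], [nu B = 0].

    On the null part [N]: it suffices to find, for every [e > 0], some [u] and
    [B <= N] with [m (phi_u^-1 B) + m (N \ B) < e], and to sum over
    [e = 2^-n].  If this fails for some [e], average [u |-> m (phi_u^-1 A)] by
    an invariant mean of the abelian group [G].  This gives an invariant
    finitely additive [lam]; the outer measure it generates restricts to an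
    invariant countably additive [nu << mu].  For every countable cover [B_k]
    of [N] the failure gives
    [e <= \sum_(k < n) m (phi_u^-1 B_k) + m (N \ \bigcup_(k < n) B_k)] for all
    [u] and [n], hence [e <= \sum_k lam B_k], and so [nu N >= e], contradicting
    the maximality of the positive part. *)

(** * Densities *)

Section density.
Context {d : measure_display} {S : measurableType d} {R : realType}.
Implicit Types (h g : S -> \bar R) (A : set S).

Import HBNNSimple.

Lemma RNderivP (mu nu : set S -> \bar R) :
  (exists h, is_density mu nu h) -> is_density mu nu (RNderiv mu nu).
Proof. by rewrite /RNderiv; case: pselect => // e _; case: cid. Qed.

Lemma finite_RNderivP (mu nu : {measure set S -> \bar R}) :
  sigma_finite setT mu -> nu setT < +oo -> nu `<< mu ->
  is_density mu nu (RNderiv mu nu).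
Proof.
move=> smu fnu numu; apply: RNderivP.
(* Both measures are repackaged with their finiteness proofs so that the Radon-Nikodym theorem for
   bundled measures applies. *)
pose mu' : {sigma_finite_measure set S -> \bar R} :=
  HB.pack (Measure.sort mu)
  (isSFinite.Build _ _ _ _ (sfinite_measure_sigma_finite smu))
  (isSigmaFinite.Build _ _ _ _ smu).
have fnu' : fin_num_fun nu by apply: lty_fin_num_fun.
have snu : sigma_finite setT nu.
  by exists (fun=> setT); rewrite ?bigcup_const.
pose nu' : {finite_measure set S -> \bar R} := HB.pack (Measure.sort nu)
  (isFinite.Build _ _ _ _ fnu')
  (isSFinite.Build _ _ _ _ (sfinite_measure_sigma_finite snu))
  (isSigmaFinite.Build _ _ _ _ snu).
have [h [h0 _ ih nuE]] := @radon_nikodym_sigma_finite _ _ _ mu' nu' numu.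
by exists h; split; [exact: measurable_int ih|split].
Qed.

(** Approximate [g] from below by simple functions and use monotone convergence on both sides. The
    density [h] may take the value [+oo]. *)
Lemma integral_density (mu nu : {measure set S -> \bar R}) h g A :
  is_density mu nu h -> measurable A -> measurable_fun A g ->
  (forall x, 0 <= g x) ->
  \int[nu]_(x in A) g x = \int[mu]_(x in A) (g x * h x).
Proof.
move=> [mh [h0 nuE]] mA mg g0.
pose p := nnsfun_approx mA mg.
have gE x : A x -> g x = lim ((EFin \o p n) x @[n --> \oo]).
  by move=> Ax; apply/esym/cvg_lim => //; exact: cvg_nnsfun_approx.
have pnd x : {homo (fun n => (p n x)%:E) : a b / (a <= b)%N >-> a <= b}.
  by move=> a b ab; rewrite lee_fin; exact/lefP/nd_nnsfun_approx.
have -> : \int[nu]_(x in A) g x =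
    lim (\int[nu]_(x in A) (EFin \o p n) x @[n --> \oo]).
  under eq_integral => x /[!inE] /gE -> //.
  apply: monotone_convergence => //.
  - move=> n; apply/measurable_EFinP.
    by apply: (measurable_funS measurableT) => //; exact/measurable_funP.
  - by move=> n x Ax //=; rewrite lee_fin.
  - by move=> x _; exact: pnd.
rewrite [RHS](_ : _ =
    lim (\int[mu]_(x in A) ((p n x)%:E * h x) @[n --> \oo])); last first.
  have ghE x : A x -> g x * h x = lim ((p n x)%:E * h x @[n --> \oo]).
    move=> Ax; apply/esym/cvg_lim => //.
    have pg : (EFin \o p n) x @[n --> \oo] --> g x by exact: cvg_nnsfun_approx.
    (* Multiplication by [+oo] is not continuous at 0. If [g x = 0], every [p n x] is 0; otherwise
       [p n x] is eventually positive, and the product is eventually constant. *)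
    have [hfin|] := boolP (h x \is a fin_num); first exact: cvgeZr.
    rewrite ge0_fin_numE// -leNgt leye_eq => /eqP ->.
    have [gx0|gx0] := eqVneq (g x) 0.
      have p0 n : (p n x)%:E = 0.
        apply/eqP; rewrite eq_le; apply/andP; split; last by rewrite lee_fin.
        rewrite -gx0 gE//.
        apply: lime_ge; first exact: ereal_nondecreasing_is_cvgn (pnd x).
        by exists n => // m; exact: pnd.
      by under eq_fun do rewrite p0 mul0e; rewrite gx0 mul0e; exact: cvg_cst.
    have gx : 0 < g x by rewrite lt0e gx0 g0.
    rewrite gt0_muley//; apply: cvg_near_cst.
    have [N pN] : exists N, (0 < p N x)%R.
      apply: contrapT => /forallNP p0; move/eqP: gx0; apply; rewrite gE//.
      apply: lim_near_cst => //; apply: nearW => n /=; congr EFin.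
      by apply/eqP; rewrite eq_le fun_ge0 andbT leNgt; exact/negP.
    exists N => // n /= Nn; rewrite gt0_muley// lte_fin (lt_le_trans pN)//.
    by rewrite -lee_fin; exact: pnd.
  under eq_integral => x /[!inE] /ghE -> //.
  apply: monotone_convergence => [//| | |].
  - move=> n; apply/emeasurable_funM; apply/measurable_funTS => //.
    exact/measurable_EFinP.
  - by move=> n x Ax /=; rewrite mule_ge0 ?lee_fin.
  - by move=> x Ax a b ab/=; rewrite lee_wpmul2r ?pnd.

(* The case of a simple function: expand over the level sets of [p n], where the claim is the
   definition of a density. *)
suff suf n : \int[mu]_(x in A) ((p n x)%:E * h x) =
    \int[nu]_(x in A) (EFin \o p n) x.
  by under [in RHS]eq_fun do rewrite suf.
transitivity (\int[nu]_(x in A)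
   (\sum_(y \in range (p n)) (y * \1_(p n @^-1` [set y]) x)%:E)); last first.
  by apply: eq_integral => t tA; rewrite /= fimfunE -fsumEFin.
have indich r : measurable_fun A (fun x => (r * \1_(p n @^-1` [set r]) x)%:E).
  by apply: (measurable_comp measurableT) => //; exact: measurable_funM.
rewrite ge0_integral_fsum//; last by move=> m y Ey; exact: nnfun_muleindic_ge0.
transitivity (\int[mu]_(x in A) (\sum_(y \in range (p n))
    (y * \1_(p n @^-1` [set y]) x)%:E * h x)).
  under [RHS]eq_integral => x xE.
    rewrite -ge0_mule_fsuml => [|y]; last exact: nnfun_muleindic_ge0.
    rewrite fsumEFin // -(fimfunE _ x); over.
  by [].
rewrite ge0_integral_fsum//; last 2 first.
  - by move=> y; apply: emeasurable_funM => //; exact: measurable_funTS.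
  - by move=> m y Ey; rewrite mule_ge0// nnfun_muleindic_ge0.
apply: eq_fsbigr => r rhn.
under [RHS]eq_integral do rewrite EFinM.
rewrite integralZl_indic_nnsfun => //.
under eq_integral do rewrite EFinM -muleA.
rewrite ge0_integralZl//.
- under eq_integral do rewrite muleC.
  rewrite (eq_integral (h \_ (p n @^-1` [set r]))); last first.
    by move=> x xE; rewrite epatch_indic.
  by rewrite -integral_mkcondr -nuE ?integral_indic// 1?setIC//;
    exact: measurableI.
- apply: emeasurable_funM; first exact/measurable_EFinP.
  exact/measurable_funTS.
- by move=> t Et; rewrite mule_ge0 ?lee_fin.
- by move: rhn; rewrite inE => -[t _ <-]; rewrite lee_fin.
Qed.

Lemma density_measure (mu : {measure set S -> \bar R}) h :
  measurable_fun setT h -> (forall s, 0 <= h s) ->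
  exists m : {measure set S -> \bar R}, is_density mu m h.
Proof.
move=> mh h0; pose m (A : set S) := \int[mu]_(x in A) h x.
have m0 : m set0 = 0 by exact: integral_set0.
have m_ge0 A : 0 <= m A by exact: integral_ge0.
pose m' : {measure set S -> \bar R} := HB.pack m
  (isMeasure.Build d S R m m0 m_ge0 (semi_sigma_additive_nng_induced mh h0)).
by exists m'.
Qed.

Lemma density_null (mu nu : {measure set S -> \bar R}) h A :
  is_density mu nu h -> measurable A -> mu A = 0 -> nu A = 0.
Proof.
move=> [mh [h0 nuE]] mA A0; rewrite nuE//; apply: null_set_integral => //.
exact: measurable_funTS.
Qed.

(** * The dual operator as a density *)

Section dual_operator.
Variables (mu m : {measure set S -> \bar R}) (phi psi : S -> S) (f : S -> R).
Hypotheses (smu : sigma_finite setT mu)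
  (mphi : measurable_fun setT phi) (mpsi : measurable_fun setT psi)
  (phiK : cancel phi psi)
  (phi_null : forall A, measurable A -> mu A = 0 -> mu (phi @^-1` A) = 0)
  (f_gt0 : forall s, (0 < f s)%R) (mf : is_density mu m (EFin \o f))
  (mfin : m setT < +oo).

Let mphi_preimage A : measurable A -> measurable (phi @^-1` A).
Proof. by move=> mA; rewrite -[X in measurable X]setTI; exact: mphi. Qed.

Let f_meas : measurable_fun setT f.
Proof. by case: mf => /measurable_EFinP. Qed.

(** [RNderiv] is 0 by default, so existence of a density has to be shown. The image of [mu] may be
    infinite, but that of [m] is finite and has a density [k]; since [mu] is [1 / f] times [m], the
    quotient of [k] by [f \o psi] is a density of the image of [mu]. *)
Lemma pushforward_RNderivP :
  is_density mu (pushforward mu phi) (RNderiv mu (pushforward mu phi)).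
Proof.
apply: RNderivP.
pose mp : {measure set S -> \bar R} :=
  measure_function_pushforward__canonical__measure_function_Measure m mphi.
have := @finite_RNderivP mu mp smu mfin.
case=> [|mk [k0 kE]].
  apply/null_content_dominatesP => A mA A0.
  by apply: density_null mf _ _; [exact: mphi_preimage|exact: phi_null].
have minv : measurable_fun setT (fun x => (f (psi x))^-1%:E).
  apply/measurable_EFinP.
  have -> : (fun x => (f (psi x))^-1%R) = (@powR R ^~ (-1)%R) \o (f \o psi).
    by apply/funext => x; rewrite /= powR_inv1// ltW.
  by apply: measurableT_comp; [exact: measurable_powR|exact: measurableT_comp].
exists (fun x => ((f (psi x))^-1)%:E * RNderiv mu mp x); split; [|split].
- exact: emeasurable_funM.
- by move=> x; rewrite mule_ge0// lee_fin invr_ge0 ltW.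
move=> A mA; rewrite -(integral_density (nu := mp))//; last 2 first.
  exact: measurable_funTS.
  by move=> x; rewrite lee_fin invr_ge0 ltW.
change (mu (phi @^-1` A) =
  \int[pushforward m phi]_(x in A) ((f (psi x))^-1)%:E).
rewrite ge0_integral_pushforward//; last 2 first.
  exact: measurable_funTS.
  by move=> x _; rewrite lee_fin invr_ge0 ltW.
rewrite (integral_density mf)//; last 3 first.
  exact: mphi_preimage.
  by apply: measurable_funTS; exact: measurableT_comp.
  by move=> x; rewrite lee_fin invr_ge0 ltW.
rewrite (eq_integral (cst 1)) => [|x _]; last first.
  by rewrite /= phiK -EFinM mulVf// gt_eqF.
by rewrite integral_cst ?mul1e//; exact: mphi_preimage.
Qed.

(** Integrating [f \o psi] against the image of [mu] under [phi] amounts to integrating [f] over the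
    preimage, because [psi] undoes [phi]. *)
Lemma dual_op_density :
  is_density mu (pushforward m phi) (dual_op mu phi psi f).
Proof.
have [mD [D0 DE]] := pushforward_RNderivP.
have mfpsi : measurable_fun setT (fun x => (f (psi x))%:E).
  by apply/measurable_EFinP; exact: measurableT_comp.
split; [exact: emeasurable_funM|split].
  by move=> s; rewrite mule_ge0// lee_fin ltW.
move=> A mA; rewrite /dual_op; under eq_integral do rewrite muleC.
pose mp : {measure set S -> \bar R} :=
  measure_function_pushforward__canonical__measure_function_Measure mu mphi.
rewrite -(@integral_density mu mp)//; last 2 first.
  exact: measurable_funTS.
  by move=> x; rewrite lee_fin ltW.
change (m (phi @^-1` A) = \int[pushforward mu phi]_(x in A) (f (psi x))%:E).
rewrite ge0_integral_pushforward//; last 2 first.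
  exact: measurable_funTS.
  by move=> x _; rewrite lee_fin ltW.
case: mf => _ [_ mE]; rewrite mE; last exact: mphi_preimage.
by apply: eq_integral => x _; rewrite /= phiK.
Qed.

End dual_operator.

End density.

(** * Invariant mean of an abelian group *)

Section invariant_mean.
Local Open Scope ring_scope.
Context {R : realType} {G : zmodType}.
Implicit Types (F : G -> R) (l : seq (G * nat)) (t g : G).

Definition avg t n F : G -> R :=
  fun g => n.+1%:R^-1 * \sum_(k < n.+1) F (g + t *+ k).

Definition avgs l F : G -> R := foldr (fun p => avg p.1 p.2) F l.

(** Commutativity of [G] enters here: the two translations can be exchanged. *)
Lemma avgC t n s m F : avg t n (avg s m F) = avg s m (avg t n F).
Proof.
apply/funext => g; rewrite /avg -!mulr_sumr mulrCA exchange_big/=.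
do 2 congr (_ * _); apply: eq_bigr => i _; apply: eq_bigr => j _.
by rewrite addrAC.
Qed.

(** Averages commute, so any factor can be moved to the outermost place. *)
Lemma avgs_mem l t n : (t, n) \in l ->
  exists l', forall F, avgs l F = avg t n (avgs l' F).
Proof.
elim: l => // -[s m] l IH; rewrite inE => /orP[/eqP[-> ->]|/IH[l' l'E]].
  by exists l.
by exists ((s, m) :: l') => F /=; rewrite l'E avgC.
Qed.

Lemma avgsD l F F' : avgs l (fun g => F g + F' g) =
  (fun g => avgs l F g + avgs l F' g).
Proof.
elim: l => //= -[t n] l ->; apply/funext => g.
by rewrite /avg -mulrDr -big_split.
Qed.

Lemma avgs_shift l t F g : avgs l (fun h => F (h + t)) g = avgs l F (g + t).
Proof.
elim: l g => //= -[s n] l IH g; rewrite /avg; congr (_ * _).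
by apply: eq_bigr => k _; rewrite IH addrAC.
Qed.

Lemma avgs_ge l (a : R) F : (forall g, a <= F g) -> forall g, a <= avgs l F g.
Proof.
move=> aF; elim: l => //= -[t n] l IH g.
rewrite /avg mulrC ler_pdivlMr// mulr_natr -[X in _ *+ X]card_ord -sumr_const.
exact: ler_sum.
Qed.

Lemma avgs_le l (b : R) F : (forall g, F g <= b) -> forall g, avgs l F g <= b.
Proof.
move=> bF; elim: l => //= -[t n] l IH g.
rewrite /avg mulrC ler_pdivrMr// mulr_natr -[X in _ *+ X]card_ord -sumr_const.
exact: ler_sum.
Qed.

Lemma avgs_bound l (C : R) F : (forall g, `|F g| <= C) ->
  forall g, `|avgs l F g| <= C.
Proof.
move=> FC g; rewrite ler_norml avgs_le ?avgs_ge// => h;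
  by have := FC h; rewrite ler_norml => /andP[].
Qed.

(** The two sums telescope: only the last term of the first and the first term of the second
    survive. *)
Lemma avg_almost_invariant t n (C : R) F : (forall g, `|F g| <= C) ->
  forall g, `|avg t n F (g + t) - avg t n F g| <= n.+1%:R^-1 * (C + C).
Proof.
move=> FC g; rewrite /avg -mulrBr normrM ger0_norm// ler_wpM2l//.
rewrite [X in _ - X]big_ord_recl big_ord_recr/= mulr0n addr0.
under [X in _ - (_ + X)]eq_bigr do rewrite /bump/= add1n mulrS addrA.
rewrite (addrC _ (F _)) (addrC (F g)) addrKA.
by rewrite (le_trans (ler_normB _ _))// lerD.
Qed.

(* For large [l], [avgs l] contains the factor [avg t n], which is invariant
   under [t] up to [O(1 / n)]; an invariant mean is the limit of [avgs l F 0]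
   along an ultrafilter refining this filter. *)
Definition large_seqs : set_system (seq (G * nat)) :=
  [set B | exists l0 : seq (G * nat), forall l, {subset l0 <= l} -> B l].

Global Instance large_seqs_filter : ProperFilter large_seqs.
Proof.
split=> [[l0 /(_ l0)]|]; first by apply.
split.
- by exists [::].
- move=> A B [l0 Al] [l1 Bl]; exists (l0 ++ l1) => l sl; split.
    by apply: Al => x xl; apply: sl; rewrite mem_cat xl.
  by apply: Bl => x xl; apply: sl; rewrite mem_cat xl orbT.
- by move=> A B AB [l0 Al]; exists l0 => l /Al/AB.
Qed.

(** [L] is total on functions, but the limit along the ultrafilter is known to exist only for
    bounded ones; hence the explicit bounds [C]. *)
Lemma invariant_mean_exists : exists L : (G -> R) -> R,
  [/\ forall F F' (C : R), (forall g, `|F g| <= C) -> (forall g, `|F' g| <= C) ->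
        L (fun g => F g + F' g) = L F + L F',
      forall F (a : R), (forall g, F g = a) -> L F = a,
      forall F (a C : R), (forall g, `|F g| <= C) -> (forall g, a <= F g) ->
        a <= L F &
      forall F t (C : R), (forall g, `|F g| <= C) ->
        L (fun g => F (g + t)) = L F].
Proof.
have [U [UU sU]] := ultraFilterLemma large_seqs_filter.
have cvgU F (C : R) : (forall g, `|F g| <= C) -> cvg (avgs l F 0 @[l --> U]).
  move=> FC.
  have : compact `[- C, C]%classic by exact: segment_compact.
  move=> /(_ ((fun l => avgs l F 0) @ U) _).
  case=> [|p [_ clp]].
    apply: (@filterE _ U) => l /=.
    by have := avgs_bound l FC 0; rewrite in_itv/= ler_norml.
  apply/cvg_ex; exists p => V pV.
  have [//|UV] := in_ultra_setVsetC ((fun l => avgs l F 0) @^-1` V) UU.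
  by have [x []] := clp (~` V) V UV pV.
exists (fun F => lim (avgs l F 0 @[l --> U])); split.
- move=> F F' C FC F'C; rewrite -limD;
    [|exact: (cvgU _ _ FC)|exact: (cvgU _ _ F'C)].
  by under eq_fun do rewrite avgsD.
- move=> F a Fa; apply: lim_near_cst => //; apply: filterE => l.
  by apply/eqP; rewrite eq_le avgs_le ?avgs_ge// => g; rewrite Fa.
- move=> F a C FC aF; apply: limr_ge; first exact: (cvgU _ _ FC).
  by apply: filterE => l; exact: avgs_ge.
- move=> F t C FC; apply/eqP; rewrite -subr_eq0 -limB; last 2 first.
    by apply: (cvgU _ C) => g; exact: FC.
    exact: (cvgU _ _ FC).
  apply/eqP/cvg_lim => //; apply/cvgr0Pnorm_le => e e0.
  have [n ne] : exists n, n.+1%:R^-1 * (C + C) <= e.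
    (* Any [n] with [n.+1] above [(C + C) / e] makes the error of [avg_almost_invariant] at most
       [e]. *)
    exists (Num.truncn ((C + C) / e)); rewrite mulrC ler_pdivrMr//.
    by rewrite mulrC -ler_pdivrMr// ltW// truncnS_gt.
  apply: sU; exists [:: (t, n)] => l /(_ (t, n)); rewrite mem_head => /(_ isT).
  move=> /avgs_mem[l' l'E]; rewrite /= !fctE avgs_shift l'E (le_trans _ ne)//.
  by apply: avg_almost_invariant; exact: avgs_bound.
Qed.

End invariant_mean.

(** * Countably additive part of a content *)

Section sigma_additive_part.
Context {d : measure_display} {S : measurableType d} {R : realType}.
Variable lam : {content set S -> \bar R}.
Implicit Types A X : set S.

(** The infimum of [lam]-sums over countable measurable covers. On measurable sets it is the largest
    measure below [lam]; for finite [lam], it is the countably additive part in the Yosida-Hewitt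
    decomposition. *)
Definition sigma_part : set S -> \bar R := mu_ext lam.

(** Cutting each member of a cover along [A] splits its content exactly, by finite additivity. *)
Lemma sigma_part_caratheodory A :
  measurable A -> (mu_ext lam).-caratheodory A.
Proof.
move=> mA; apply: le_caratheodory_measurable => X.
apply: le_ereal_inf_tmp => _ [B [mB XB] <-].
have mBA k : measurable (B k `&` A) by exact: measurableI.
have mBC k : measurable (B k `&` ~` A).
  by apply: measurableI => //; exact: measurableC.
have -> : \sum_(k <oo) lam (B k) =
    \sum_(k <oo) lam (B k `&` A) + \sum_(k <oo) lam (B k `&` ~` A).
  rewrite -nneseriesD//; apply: eq_eseriesr => k _.
  rewrite -measureU//; first by rewrite -setIUr setUv setIT.
  by rewrite setIACA setICr setI0.
apply: leeD; apply: ereal_inf_lbound.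
- exists (fun k => B k `&` A) => //; split => // x [/XB[k _ Bx] Ax].
  by exists k.
- exists (fun k => B k `&` ~` A) => //; split => // x [/XB[k _ Bx] Ax].
  by exists k.
Qed.

Let sigma_part0 : sigma_part set0 = 0.
Proof. exact: outer_measure0. Qed.

Let sigma_part_ge0 A : 0 <= sigma_part A.
Proof. exact: outer_measure_ge0. Qed.

Let sigma_part_sigma_additive : semi_sigma_additive sigma_part.
Proof.
move=> F mF tF mUF.
apply: (@caratheodory_measure_sigma_additive R S (mu_ext lam)) => //.
- by move=> i; exact: sigma_part_caratheodory.
- exact: sigma_part_caratheodory.
Qed.

HB.instance Definition _ := isMeasure.Build d S R sigma_part
  sigma_part0 sigma_part_ge0 sigma_part_sigma_additive.

Lemma sigma_part_le A : measurable A -> sigma_part A <= lam A.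
Proof.
move=> mA; apply: ereal_inf_lbound.
exists (fun k => if k is 0%N then A else set0).
  split=> [[|]//|x Ax]; first by exists 0%N.
rewrite (nneseries_split 0 1)// big_nat1 eseries0 ?adde0// => -[|i]//.
Qed.

(** A cover of [A] pulls back to a cover of the preimage with the same sum. The reverse inequality
    comes from applying this to the inverse map. *)
Lemma sigma_part_preimage_le (T : S -> S) A : measurable_fun setT T ->
  (forall B, measurable B -> lam (T @^-1` B) = lam B) ->
  sigma_part (T @^-1` A) <= sigma_part A.
Proof.
move=> mT lamT; apply: le_ereal_inf_tmp => _ [B [mB AB] <-].
apply: ereal_inf_lbound; exists (fun k => T @^-1` B k).
  split=> [k|x /AB[k _ Bx]]; last by exists k.
  by rewrite -[X in measurable X]setTI; exact: mT.
by apply: eq_eseriesr => k _; exact: lamT.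
Qed.

End sigma_additive_part.

(** * Positive and null parts *)

(** A nonnegative function has zero integral over [A] exactly when it vanishes almost everywhere on
    [A]. *)
Lemma density_null_setP {d : measure_display} {S : measurableType d}
    {R : realType} (mu nu : {measure set S -> \bar R}) (h : S -> \bar R)
    (A : set S) : is_density mu nu h -> measurable A ->
  nu A = 0 <-> mu (A `&` [set s | 0 < h s]) = 0.
Proof.
move=> [mh [h0 nuE]] mA.
have mA' : measurable (A `&` [set s | 0 < h s]).
  by apply: emeasurable_fun_o_infty => //; exact: measurable_funTS.
have mhA : measurable_fun A h by exact: measurable_funTS.
rewrite nuE//; split=> [hA0|A0].
  have := (ae_eq_integral_abs mu mA mhA).1.
  under eq_integral do rewrite gee0_abs//.
  move=> /(_ hA0) [B [mB B0 AB]].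
  apply: subset_measure0 mA' mB _ B0; apply: subset_trans AB.
  by move=> s [As /= hs] /(_ As) hs0; move: hs; rewrite hs0 ltxx.
rewrite (ge0_negligible_integral mA' mA)//; apply: integral0_eq => s [As].
move=> /not_andP[//|/negP]; rewrite -leNgt => hs.
by apply/eqP; rewrite eq_le hs/=.
Qed.

(** * Small sets on the null part *)

Section null_part.
Context {d : measure_display} {S : measurableType d} {R : realType}
  {G : zmodType}.
Variables (mu m : {measure set S -> \bar R}) (phi : G -> S -> S).
Hypotheses (phi0 : phi 0%R = id)
  (phiD : forall u v, phi (u + v)%R = phi u \o phi v)
  (mphi : forall t, measurable_fun setT (phi t))
  (phi_null : forall t A, measurable A -> mu A = 0 -> mu (phi t @^-1` A) = 0)
  (mfin : m setT < +oo)
  (m_null : forall A, measurable A -> mu A = 0 -> m A = 0).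
Implicit Types (A B N : set S) (t u : G).

Let mpre t A : measurable A -> measurable (phi t @^-1` A).
Proof. by move=> mA; rewrite -[X in measurable X]setTI; exact: mphi. Qed.

Let m_fin A : measurable A -> m A \is a fin_num.
Proof. by apply/lty_fin_num_fun. Qed.

Lemma null_part_small N (e : R) : measurable N ->
  (forall nu : {measure set S -> \bar R}, Lambda mu phi nu -> nu N = 0) ->
  (0 < e)%R ->
  exists u B, [/\ measurable B, B `<=` N &
    m (phi u @^-1` B) + m (N `\` B) < e%:E].
Proof.
move=> mN noinv e0; apply: contrapT => H.
have He u B : measurable B -> B `<=` N ->
    e%:E <= m (phi u @^-1` B) + m (N `\` B).
  by move=> mB BN; rewrite leNgt; apply/negP => ?; apply: H; exists u, B.
have [L [LD Lc Lge Lsh]] := @invariant_mean_exists R G.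
pose F A u := fine (m (phi u @^-1` A)).
pose M : R := fine (m setT).
have M0 : (0 <= M)%R by exact: fine_ge0.
have F0 A u : (0 <= F A u)%R by exact: fine_ge0.
have FM A u : measurable A -> (`|F A u| <= M)%R.
  move=> mA; rewrite ger0_norm//; apply: fine_le.
  - exact/m_fin/mpre.
  - exact: m_fin.
  - by apply: le_measure; rewrite ?inE//; exact: mpre.
(* A content is a function on all sets; off the measurable ones the value 0 is a placeholder that
   keeps [lam] nonnegative. *)
pose lam A : \bar R := if pselect (measurable A) then (L (F A))%:E else 0.
have lamE A : measurable A -> lam A = (L (F A))%:E.
  by rewrite /lam; case: pselect.
have lam0 : lam set0 = 0.
  by rewrite lamE// (Lc _ 0%R)// => u; rewrite /F preimage_set0 measure0.
have lam_ge0 A : 0 <= lam A.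
  rewrite /lam; case: pselect => //= mA; rewrite lee_fin.
  by apply: (Lge _ _ M) => // u; exact: FM.
have lam_add : measure_function.semi_additive lam.
  apply/additive2P => // A B mA mB AB.
  rewrite !lamE//; last exact: measurableU.
  rewrite -EFinD -(LD _ _ M); [|by move=> u; exact: FM|by move=> u; exact: FM].
  congr (L _)%:E; apply/funext => u; rewrite /F preimage_setU measureU ?fineD//.
  - exact/m_fin/mpre.
  - exact/m_fin/mpre.
  - exact: mpre.
  - exact: mpre.
  - by rewrite -preimage_setI AB preimage_set0.
pose lamc : {content set S -> \bar R} :=
  HB.pack lam (isContent.Build d S R lam lam_ge0 lam_add).
have lamT t A : measurable A -> lam (phi t @^-1` A) = lam A.
  move=> mA; rewrite !lamE//; last exact: mpre.
  (* Pulling [A] back by [phi t] translates the function [F A] by [t], which the mean ignores. *)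
  rewrite -[in RHS](Lsh _ t M) => [|u]; last exact: FM.
  by congr (L _)%:E; apply/funext => u; rewrite /F addrC phiD.
pose nu : {measure set S -> \bar R} := sigma_part lamc.
have nuL : Lambda mu phi nu.
  split; [|split].
  - by apply: (le_lt_trans (sigma_part_le lamc measurableT));
    rewrite /= lamE// ltry.
  - apply/null_content_dominatesP => A mA A0.
    apply/eqP; rewrite -measure_le0.
    rewrite (le_trans (sigma_part_le lamc mA))//= lamE//.
    rewrite (Lc _ 0%R)// => u; rewrite /F m_null ?phi_null//; exact: mpre.
  - move=> t A mA; apply/eqP; rewrite eq_le; apply/andP; split.
      by apply: sigma_part_preimage_le => // B mB; exact: lamT.
    have {1}-> : A = phi (- t)%R @^-1` (phi t @^-1` A).
      by rewrite -comp_preimage -phiD subrr phi0.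
    by apply: sigma_part_preimage_le => // B mB; exact: lamT.
suff : e%:E <= nu N by rewrite noinv// lee_fin leNgt e0.
apply: le_ereal_inf_tmp => _ [B [mB NB] <-]; rewrite -/lam.
(* The part of [N] left uncovered by the first [n] sets; it decreases to the empty set, so its
   [m]-measure tends to 0. *)
pose C n := N `\` \big[setU/set0]_(k < n) B k.
have mC n : measurable (C n).
  by apply: measurableD => //; exact: bigsetU_measurable.
have mC0 : m (C n) @[n --> \oo] --> 0.
  have capC : \bigcap_n C n = set0.
    rewrite -subset0 => s Cs; have [Ns _] := Cs 0%N I.
    have [k _ Bk] := NB _ Ns; have [_] := Cs k.+1 I; apply.
    by rewrite -bigcup_mkord; exists k => /=.
  rewrite -(measure0 m) -capC; apply: nonincreasing_cvg_mu => //.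
  - by rewrite ltey_eq m_fin.
  - by rewrite capC.
  - move=> n k nk; apply/subsetPset; apply: setDS.
    exact: subset_bigsetU.
have Lsum n : L (fun u => \sum_(k < n) F (B k) u)%R =
    (\sum_(k < n) L (F (B k)))%R.
  elim: n => [|n IH].
    by rewrite big_ord0; apply: Lc => u; rewrite big_ord0.
  (* Additivity of [L] asks for one common bound; [M *+ n.+1] dominates both the partial sum and the
     new term. *)
  rewrite big_ord_recr/= -IH -(LD _ _ (M *+ n.+1)%R).
  - by congr L; apply/funext => u; rewrite big_ord_recr.
  - move=> u; rewrite (le_trans (ler_norm_sum _ _ _))//.
    rewrite (@le_trans _ _ (\sum_(k < n) M)%R)//.
      by apply: ler_sum => k _; exact: FM.
    by rewrite sumr_const card_ord ler_wpMn2l.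
  - by move=> u; rewrite (le_trans (FM _ _ _))// mulrS lerDl mulrn_wge0.
have bound n : e%:E <= \sum_(0 <= k <oo) lam (B k) + m (C n).
  apply: (@le_trans _ _ (\sum_(0 <= k < n) lam (B k) + m (C n))); last first.
    by rewrite leeD2r//; exact: nneseries_lim_ge.
  rewrite big_mkord; under eq_bigr do rewrite lamE//.
  rewrite sumEFin -Lsum -leeBlDr ?m_fin//.
  rewrite -(fineK (m_fin (mC n))) -EFinB lee_fin.
  (* The lower bound [e - m (C n)] holds for every [u], so it passes to the mean. *)
  apply: (Lge _ _ (\sum_(k < n) M)%R).
    move=> u; rewrite (le_trans (ler_norm_sum _ _ _))//.
    by apply: ler_sum => k _; exact: FM.
  move=> u; rewrite lerBlDr -lee_fin EFinD fineK ?m_fin//.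
  (* The assumed failure is used on [D], the part of [N] already covered, whose complement in [N] is
     [C n]. *)
  pose D := N `&` \big[setU/set0]_(k < n) B k.
  have mD : measurable D by apply: measurableI => //; exact: bigsetU_measurable.
  have -> : C n = N `\` D by rewrite /D setDIr setDv set0U.
  apply: (le_trans (He u D mD (@subIsetl _ _ _))); rewrite leeD2r//.
  rewrite -sumEFin.
  under eq_bigr => k _ do rewrite /F fineK ?(m_fin (mpre _ (mB _)))//.
  apply: (@content_subadditive _ _ _ m _ (fun k => phi u @^-1` B k))
    => [k _||].
  - exact: mpre.
  - exact: mpre.
  - rewrite -(bigcup_mkord n (fun k => phi u @^-1` B k)) => s [_].
    by rewrite -bigcup_mkord => -[k kn Bs]; exists k.
set s := \sum_(0 <= k <oo) lam (B k) in bound *.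
have cvs : s + m (C n) @[n --> \oo] --> s + 0.
  by apply: cvgeD => //; [rewrite fin_num_adde_defl|exact: cvg_cst].
rewrite adde0 in cvs; rewrite -(cvg_lim _ cvs)//.
by apply: lime_ge; [apply/cvg_ex; exists s|exact: nearW].
Qed.

End null_part.

(** * Behaviour of the series on the two parts *)

Section positive_part.
Context {d : measure_display} {S : measurableType d} {R : realType}
  {G : zmodType}.
Variables (mu m : {measure set S -> \bar R}) (phi : G -> S -> S).
Hypotheses (smu : sigma_finite setT mu)
  (phi0 : phi 0%R = id)
  (phiD : forall u v, phi (u + v)%R = phi u \o phi v)
  (mphi : forall t, measurable_fun setT (phi t))
  (phi_null : forall t A, measurable A -> mu A = 0 -> mu (phi t @^-1` A) = 0)
  (mfin : m setT < +oo)
  (m_null : forall A, measurable A -> m A = 0 <-> mu A = 0).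
Implicit Types (A B N P : set S) (t : G) (u : nat -> G)
  (nu : {measure set S -> \bar R}).

Let mpre t A : measurable A -> measurable (phi t @^-1` A).
Proof. by move=> mA; rewrite -[X in measurable X]setTI; exact: mphi. Qed.

Lemma Lambda_density nu : Lambda mu phi nu -> is_density mu nu (RNderiv mu nu).
Proof. by move=> [nufin [numu _]]; exact: finite_RNderivP. Qed.

Lemma measurable_supp_set nu : Lambda mu phi nu -> measurable (supp_set mu nu).
Proof.
move=> /Lambda_density[mh _]; rewrite -[supp_set _ _]setTI.
exact: emeasurable_fun_o_infty.
Qed.

(** By [density_null_setP], [nu] and the restriction of [mu] to the support have the same null sets;
    changing the support by a [mu]-null set does not affect this. *)
Lemma Lambda_null_setP nu P A : Lambda mu phi nu -> measurable P ->
  mu (symdiff P (supp_set mu nu)) = 0 -> measurable A ->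
  nu A = 0 <-> mu (A `&` P) = 0.
Proof.
move=> nuL mP PS mA; have mS := measurable_supp_set nuL.
have key X Y : measurable X -> measurable Y -> mu (symdiff X Y) = 0 ->
    mu (A `&` X) = 0 -> mu (A `&` Y) = 0.
  move=> mX mY XY0 AX0.
  have mXY : measurable (symdiff X Y) by apply: measurableU; exact: measurableD.
  have mAX : measurable (A `&` X) by exact: measurableI.
  have mAY : measurable (A `&` Y) by exact: measurableI.
  have U0 : mu ((A `&` X) `|` symdiff X Y) = 0 by rewrite measureU0.
  apply: subset_measure0 mAY (measurableU _ _ mAX mXY) _ U0.
  move=> s [As Ys]; have [Xs|Xs] := pselect (X s); first by left.
  by right; right.
apply: (iff_trans (density_null_setP (Lambda_density nuL) mA)).
rewrite -/(supp_set mu nu); split; last exact: key.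
by apply: key => //; rewrite /symdiff setUC.
Qed.

(* [nu (phi_t^-1 (~` P)) = nu (~` P) = 0] gives one inclusion for every [t]; the
   other is its image under [phi_(- t)]. *)
Lemma positive_part_invariant nu P t : Lambda mu phi nu -> measurable P ->
  mu (symdiff P (supp_set mu nu)) = 0 ->
  mu (symdiff (phi t @^-1` P) P) = 0.
Proof.
move=> nuL mP PS; have nuP := Lambda_null_setP nuL mP PS.
have PtP v : mu (P `\` phi v @^-1` P) = 0.
  rewrite setDE setIC preimage_setC; apply/nuP; first exact/mpre/measurableC.
  have [_ [_ ->]] := nuL; last exact: measurableC.
  by apply/nuP; [exact: measurableC|rewrite setIC setICr measure0].
have mPt v : measurable (P `\` phi v @^-1` P).
  by apply: measurableD => //; exact: mpre.
rewrite /symdiff measureU0//; last by apply: measurableD => //; exact: mpre.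
have -> : phi t @^-1` P `\` P = phi t @^-1` (P `\` phi (- t)%R @^-1` P).
  rewrite -[RHS]/(phi t @^-1` P `\` (phi (- t)%R \o phi t) @^-1` P).
  by rewrite -phiD addNr phi0.
exact: phi_null.
Qed.

Lemma Lambda_summable_null nu u B : Lambda mu phi nu -> measurable B ->
  \sum_(0 <= n <oo) m (phi (u n) @^-1` B) < +oo -> nu B = 0.
Proof.
move=> [nufin [/null_content_dominatesP numu nuT]] mB sB.
pose F n := phi (u n) @^-1` B.
have mF n : measurable (F n) by exact: mpre.
have mlim : measurable (lim_sup_set F).
  by apply: bigcapT_measurable => n; exact: bigcup_measurable.
have lim0 : nu (lim_sup_set F) = 0.
  by apply: numu => //; apply/m_null => //; exact: lim_sup_set_cvg0.
have mU n : measurable (\bigcup_(k >= n) F k) by exact: bigcup_measurable.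
have nuU0 : nu (\bigcup_(k >= 0) F k) < +oo.
  by rewrite (le_lt_trans _ nufin)// le_measure ?inE.
have cvF := lim_sup_set_cvg nu F mF nuU0.
suff : nu B <= 0 by rewrite measure_le0 => /eqP.
rewrite -lim0 -(cvg_lim _ cvF)//.
apply: lime_ge; first by apply/cvg_ex; exists (nu (lim_sup_set F)).
(* The [n]-th tail union contains [F n], whose [nu]-measure is [nu B] by invariance; so the limsup
   has measure at least [nu B]. *)
apply: nearW => n; rewrite -(nuT (u n) B mB) le_measure ?inE//.
  exact: mF.
by move=> s Fs; exists n => /=.
Qed.

Lemma positive_part_series nu P u (h : nat -> S -> \bar R) :
  Lambda mu phi nu -> measurable P ->
  mu (symdiff P (supp_set mu nu)) = 0 ->
  (forall n, is_density mu (pushforward m (phi (u n))) (h n)) ->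
  {ae mu, forall s, P s -> \sum_(0 <= n <oo) h n s = +oo}.
Proof.
move=> nuL mP PS hE; have nuP := Lambda_null_setP nuL mP PS.
have [F FT mF] := smu.
have mh n : measurable_fun setT (h n) by case: (hE n).
have h0 n s : 0 <= h n s by case: (hE n) => _ [].
pose g s := \sum_(0 <= n <oo) h n s.
have mg : measurable_fun setT g by exact: ge0_emeasurable_sum.
(* These sets exhaust the points of [P] where the series is finite. On each, [mu] is finite and the
   series bounded, so it is integrable and [Lambda_summable_null] applies. *)
pose B j k := F j `&` P `&` [set s | g s <= k%:R%:E].
have mFP j : measurable (F j `&` P) by apply: measurableI => //; case: (mF j).
have mB j k : measurable (B j k).
  by apply: emeasurable_fun_infty_c => //; exact: measurable_funTS.
have B0 j k : mu (B j k) = 0.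
  have -> : B j k = B j k `&` P by rewrite /B setIAC -[in RHS]setIA setIid.
  apply/nuP => //; apply: (@Lambda_summable_null nu u) => //.
  rewrite (eq_eseriesr (g := fun n => \int[mu]_(s in B j k) h n s)); last first.
    by move=> n _; have [_ [_ <-]] := hE n.
  rewrite -integral_nneseries//; last by move=> n; exact: measurable_funTS.
  apply: (@le_lt_trans _ _ (\int[mu]_(s in B j k) k%:R%:E)).
    apply: ge0_le_integral => //.
    - by move=> s _; exact: nneseries_ge0.
    - exact: measurable_funTS.
    - by move=> s [].
  rewrite integral_cst// lte_mul_pinfty// ?lee_fin//.
  have [mFj] := mF j; apply: le_lt_trans; apply: le_measure; rewrite ?inE//.
  by move=> s [[]].
change (mu.-negligible (~` [set s | P s -> g s = +oo])).
apply: (@negligibleS _ _ _ _ (\bigcup_j \bigcup_k B j k)); last first.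
  apply: negligible_bigcup => j; apply: negligible_bigcup => k.
  exact: (negligibleP mu (mB j k)).2 (B0 j k).
move=> s /= /not_implyP[Ps gs].
have [j _ Fs] : (\bigcup_i F i) s by rewrite -FT.
have gfin : g s \is a fin_num.
  by rewrite ge0_fin_numE ?ltey; [exact/eqP|exact: nneseries_ge0].
exists j => //; exists (Num.truncn (fine (g s))).+1 => //; split => //=.
by rewrite -(fineK gfin) lee_fin ltW// truncnS_gt.
Qed.

(** Choose [u n] and [B n] by [null_part_small] with error [2^-(n+1)]. Almost every point of [N]
    lies in all but finitely many [B n], and the series of the [h n] cut to [B n] has finite
    integral. *)
Lemma null_part_series N :
  measurable N ->
  (forall nu, Lambda mu phi nu -> nu N = 0) ->
  exists u, forall h : nat -> S -> \bar R,
  (forall n, is_density mu (pushforward m (phi (u n))) (h n)) ->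
  {ae mu, forall s, N s -> \sum_(0 <= n <oo) h n s < +oo}.
Proof.
move=> mN noinv.
have m_null' A : measurable A -> mu A = 0 -> m A = 0 by move=> mA /m_null ->.
have eps n : (0 < 1 / (2 ^ n.+1)%:R :> R)%R.
  by rewrite divr_gt0// ltr0n expn_gt0.
have [u /choice[B uB]] := choice (fun n =>
  null_part_small phi0 phiD mphi phi_null mfin m_null' mN noinv (eps n)).
exists u => h hE.
have mB n : measurable (B n) by case: (uB n).
have mNB n : measurable (N `\` B n) by exact: measurableD.
have mh n : measurable_fun setT (h n) by case: (hE n).
have h0 n s : 0 <= h n s by case: (hE n) => _ [].
have sum1 : \sum_(0 <= n <oo) (1 / (2 ^ n.+1)%:R)%:E < +oo :> \bar R.
  by rewrite (le_lt_trans (epsilon_trick0 xpredT _))// ltry.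
have small1 n : m (phi (u n) @^-1` B n) <= (1 / (2 ^ n.+1)%:R)%:E.
  by have [_ _ /ltW] := uB n; apply: le_trans; rewrite leeDl.
have small2 n : m (N `\` B n) <= (1 / (2 ^ n.+1)%:R)%:E.
  by have [_ _ /ltW] := uB n; apply: le_trans; rewrite leeDr.
have ae1 : {ae mu, forall s, ~ lim_sup_set (fun n => N `\` B n) s}.
  have mlim : measurable (lim_sup_set (fun n => N `\` B n)).
    by apply: bigcapT_measurable => n; exact: bigcup_measurable.
  exists (lim_sup_set (fun n => N `\` B n)); split => //.
    apply/m_null => //; apply: lim_sup_set_cvg0 => //.
    by apply: le_lt_trans sum1; exact: lee_nneseries.
  by move=> s /= /contrapT.
have ae2 : {ae mu, forall s, \sum_(0 <= n <oo) (h n \_ (B n)) s \is a fin_num}.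
  have mhB n : measurable_fun setT (h n \_ (B n)).
    by apply/measurable_restrict => //; rewrite setTI; exact: measurable_funTS.
  have hB0 n s : 0 <= (h n \_ (B n)) s by rewrite erestrict_ge0.
  have : mu.-integrable setT (fun s => \sum_(0 <= n <oo) (h n \_ (B n)) s).
    apply/integrableP; split; first exact: ge0_emeasurable_sum.
    under eq_integral do rewrite gee0_abs ?nneseries_ge0//.
    rewrite integral_nneseries//; apply: le_lt_trans sum1.
    apply: lee_nneseries => [n *|n _]; first by apply: integral_ge0 => s _.
    rewrite -integral_mkcond; have [_ [_ <-//]] := hE n; exact: small1.
  by move=> /(integrable_ae measurableT); apply: filterS => s; exact.
(* This handles the finitely many initial terms at points not yet in [B n]. *)
have ae3 : {ae mu, forall s n, h n s \is a fin_num}.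
  apply: ae_foralln => n.
  have : mu.-integrable setT (h n).
    apply/integrableP; split => //.
    under eq_integral do rewrite gee0_abs//.
    by have [_ [_ <-]] := hE n.
  by move=> /(integrable_ae measurableT); apply: filterS => s; exact.
apply: filterS3 ae1 ae2 ae3 => s s1 s2 s3 Ns.
have [n0 Bs] : exists n0, forall n, (n0 <= n)%N -> B n s.
  apply: contrapT => /forallNP H; apply: s1 => n _.
  have /existsNP[k /not_implyP[nk Bk]] := H n.
  by exists k.
rewrite (nneseries_split 0 n0)// add0n lte_add_pinfty//.
  by apply: lte_sum_pinfty => n _; rewrite -ge0_fin_numE.
have hB0 n : 0 <= (h n \_ (B n)) s by rewrite erestrict_ge0.
apply: (@le_lt_trans _ _ (\sum_(n0 <= n <oo) (h n \_ (B n)) s)).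
  apply: lee_lim; [exact: is_cvg_nneseries|exact: is_cvg_nneseries|].
  apply: nearW => n; rewrite big_nat [leRHS]big_nat.
  by apply: lee_sum => k /andP[/Bs Bk _]; rewrite patchT ?inE.
move: s2; rewrite ge0_fin_numE; last exact: nneseries_ge0.
apply: le_lt_trans; rewrite [leRHS](nneseries_split 0 n0)// add0n leeDr//.
exact: sume_ge0.
Qed.

End positive_part.

Unset Implicit Arguments.

Theorem mainTheorem2 (d : measure_display) (S : measurableType d)
  (R : realType) (mu : {measure set S -> \bar R})
  (G : topologicalZmodType) (phi : G -> S -> S) (P : set S) (f : S -> R) :
  standard_borel S R ->
  sigma_finite [set: S] mu ->
  locally_compact [set: G] ->
  measurable_action phi ->
  (forall t, nonsingular mu (phi t)) ->
  is_positive_part mu phi P ->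
  mu.-integrable [set: S] (EFin \o f) ->
  (forall s, (0 < f s)%R) ->
  let N := ~` P in
  [/\ (forall t, mu (symdiff (phi t @^-1` P) P) = 0 /\
                 mu (symdiff (phi t @^-1` N) N) = 0),
      (forall u : nat -> G,
         {ae mu, forall s, P s ->
            \sum_(0 <= n <oo) dual_op mu (phi (u n)) (phi (- u n)%R) f s = +oo})
    & (exists u : nat -> G,
         {ae mu, forall s, N s ->
            \sum_(0 <= n <oo) dual_op mu (phi (u n)) (phi (- u n)%R) f s < +oo})].
Proof.
move=> _ smu _ [phi0 [phiD _]] ns [mP [[nu [nuL PS]] Pmax]] intf f0 N.
have mphi t : measurable_fun setT (phi t) by case: (ns t) => _ [].
have phi_null t A : measurable A -> mu A = 0 -> mu (phi t @^-1` A) = 0.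
  by move=> mA; have [_ [_ [_ /(_ A mA)[]]]] := ns t.
have mN : measurable N by exact: measurableC.
have fge0 s : 0 <= (EFin \o f) s by rewrite lee_fin ltW.
have [m mf] := density_measure mu (measurable_int mu intf) fge0.
have mfin : m setT < +oo.
  have [_ [_ ->//]] := mf; have /integrableP[_] := intf.
  by under eq_integral do rewrite gee0_abs//.
have m_null A : measurable A -> m A = 0 <-> mu A = 0.
  move=> mA; apply: (iff_trans (density_null_setP mf mA)).
  (* Strict positivity of [f] is what makes [m] and [mu] equivalent. *)
  suff -> : [set s | 0 < (EFin \o f) s] = setT by rewrite setIT.
  by apply/seteqP; split => // s _ /=; rewrite lte_fin.
have dualE t : is_density mu (pushforward m (phi t))
    (dual_op mu (phi t) (phi (- t)%R) f).
  apply: dual_op_density => //; last exact: phi_null.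
  by move=> s; rewrite -[LHS]/((phi (- t)%R \o phi t) s) -phiD addNr phi0.
split.
- move=> t.
  have Pt := positive_part_invariant smu phi0 phiD mphi phi_null t nuL mP PS.
  split=> //; rewrite -Pt; congr (mu _).
  rewrite /symdiff /N -preimage_setC !setDE !setCK setUC.
  by congr (_ `|` _); rewrite setIC.
- move=> u; exact: (positive_part_series smu mphi m_null nuL mP PS
    (fun n => dualE (u n))).
(* By maximality of [P], the support of any invariant [la] meets [N] in a [mu]-null set. *)
- have noinv (la : {measure set S -> \bar R}) : Lambda mu phi la -> la N = 0.
    move=> laL; apply/(density_null_setP (Lambda_density smu laL) mN).
    have := Pmax _ laL; rewrite /supp_set setDE; by rewrite setIC.
  have [u Hu] := null_part_series phi0 phiD mphi phi_null mfin m_null mN noinv.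
  by exists u; exact: (Hu _ (fun n => dualE (u n))).
Qed.
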